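(* Let $P=\{P_n(x)\}_{n=0}^\infty$ be a sequence of orthogonal polynomials on an interval $(l,r)$ of the real line with weight function $w$, satisfying the Rodrigues type formula $$P_n(x)=\frac{\epsilon_n}{w(x)}\frac{d^n}{dx^n}\left[f(x)^nw(x)\right],\qquad n\ge0,$$ where $\epsilon_n$ are constants and $f$ is a polynomial of degree at most $2$. Let $M(x)=\frac{ax+b}{cx+d}$ with $a,b,c,d\in\mathbb{C}$ and $\Delta=ad-bc\neq0$, and set $R_n(x)=P_n(M(x))$ and $Q_n(x)=(cx+d)^nP_n(M(x))$. Then, for all $n\ge0$, $$R_n(x)=\frac{\Delta^{2n}}{(cx+d)^2}\frac{\epsilon_n}{\omega(x)}D_x^n\left[\frac{F(x)^n}{(cx+d)^{4n-2}}\,\omega(x)\right]$$ and $$Q_n(x)=\frac{\Delta^{2n}}{(cx+d)^{n+2}}\frac{\epsilon_n}{\omega_{n,n}(x)}D_x^n\left[\frac{\mathcal{F}(x)^n}{(cx+d)^{2n-2}}\,\omega_{n,n}(x)\right],$$ where $$F(x)=\mathcal{F}(x)=\frac{(cx+d)^4}{\Delta^2}f(M(x)),\quad \omega(x)=\Delta\frac{w(M(x))}{(cx+d)^2},\quad \omega_{n,n}(x)=\frac{\omega(x)}{(cx+d)^{2n}},$$ and $D_x$ is the differential operator $$D_x=\frac{1}{M'(x)}\frac{d}{dx}=\frac{(cx+d)^2}{\Delta}\frac{d}{dx}.$$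
   Context: A sequence of orthogonal polynomials on $(l,r)\subseteq\mathbb{R}$ is a sequence of real polynomials $P_n$ with $\deg P_n=n$ such that $\int_l^rP_mP_nw\,dx=K_m\delta_{m,n}$, $K_m>0$; here $w$ is nonvanishing and sufficiently differentiable on $(l,r)$. In the classical setting $f$ is the leading coefficient of the differential equation $fP_n''+gP_n'+h_nP_n=0$ satisfied by the $P_n$. The identities are understood at the finite points $x$ of the curve $\Gamma=\{W(t):l<t<r\}$, where $W(x)=-\frac{dx-b}{cx-a}$ is the inverse of $M$ (so $M(x)\in(l,r)$), and derivatives are taken along $\Gamma$, i.e. $\frac{d\phi}{dx}(W(t))=\frac{d}{dt}[\phi(W(t))]/W'(t)$. *)

(* Defs.v *)
From HB Require Import structures.
From mathcomp Require Import all_boot all_order all_algebra.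
From mathcomp Require Export complex.
From mathcomp Require Import all_classical all_reals all_analysis.
Import Order.TTheory GRing.Theory Num.Theory.
Import numFieldNormedType.Exports.

Set Implicit Arguments.
Unset Strict Implicit.
Unset Printing Implicit Defensive.

Local Open Scope classical_set_scope.
Local Open Scope complex_scope.
Local Open Scope ring_scope.

(* The endpoints may be infinite. *)
Definition ointerval (R : realType) (l r : \bar R) : set R :=
  [set t : R | (l < t%:E)%E /\ (t%:E < r)%E].

Definition smooth_on (R : realType) (A : set R) (w : R -> R) : Prop :=
  forall (k : nat) (t : R), A t -> derivable (derive1n k w) t 1.

Definition orthogonal_polynomials (R : realType) (l r : \bar R) (w : R -> R)
    (P : nat -> {poly R}) : Prop :=
  (forall n : nat, size (P n) = n.+1) /\
  exists K : nat -> R,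
    (forall m : nat, 0 < K m) /\
    (forall m n : nat,
       let g := fun t : R => (((P m).[t] * (P n).[t] * w t)%:E : \bar R) in
       (@lebesgue_measure R).-integrable (ointerval l r) g /\
       (\int[@lebesgue_measure R]_(t in ointerval l r) g t)%E
         = (if m == n then K m else 0)%:E).

Definition rodrigues (R : realType) (l r : \bar R) (w : R -> R)
    (P : nat -> {poly R}) (eps : nat -> R) (f : {poly R}) : Prop :=
  forall (n : nat) (t : R), ointerval l r t ->
    (P n).[t] = eps n / w t * derive1n n (fun s : R => f.[s] ^+ n * w s) t.

Definition complex_eval (R : realType) (p : {poly R}) (z : R[i]) : R[i] :=
  (map_poly (real_complex R) p).[z].

(* A function of a real variable, read as a complex-valued function of a
   complex variable; only its values at real points z are meaningful. *)
Definition on_real (R : realType) (w : R -> R) (z : R[i]) : R[i] :=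
  (w (complex.Re z))%:C.

(* Derivative of a complex-valued function of a real variable (R[i] has no
   canonical normed R-module structure, hence the components). *)
Definition derive1C (R : realType) (h : R -> R[i]) (t : R) : R[i] :=
  Complex (derive1 (fun s : R => complex.Re (h s)) t)
          (derive1 (fun s : R => complex.Im (h s)) t).

Definition moebius (R : realType) (a b c d x : R[i]) : R[i] :=
  (a * x + b) / (c * x + d).

(* Inverse of [moebius a b c d], on real parameters; infinite at c t = a. *)
Definition moebius_inv (R : realType) (a b c d : R[i]) (t : R) : R[i] :=
  - ((d * t%:C - b) / (c * t%:C - a)).

(* The finite points of the curve parametrized by [moebius_inv]. *)
Definition Gamma (R : realType) (l r : \bar R) (a b c d : R[i]) : set R[i] :=
  [set x | exists t : R, [/\ ointerval l r t, c * t%:C != a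
                           & x = moebius_inv a b c d t]].

(* d phi / dx along the curve, at x = W(t) with W = moebius_inv a b c d; the
   parameter is recovered as t = M(x), which is real when x is on the curve. *)
Definition curve_derive (R : realType) (a b c d : R[i]) (phi : R[i] -> R[i])
    (x : R[i]) : R[i] :=
  let t := complex.Re (moebius a b c d x) in
  derive1C (fun s : R => phi (moebius_inv a b c d s)) t
    / derive1C (moebius_inv a b c d) t.

(* (1 / M'(x)) d/dx *)
Definition Dx (R : realType) (a b c d : R[i]) (phi : R[i] -> R[i])
    (x : R[i]) : R[i] :=
  (curve_derive a b c d (moebius a b c d) x)^-1 * curve_derive a b c d phi x.

(* Main.v *)
Require Import Defs.
From HB Require Import structures.
From mathcomp Require Import all_boot all_order all_algebra.
From mathcomp Require Import complex.
From mathcomp Require Import all_classical all_reals all_analysis.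
From mathcomp Require Import ring.
Import Order.TTheory GRing.Theory Num.Theory.
Import numFieldNormedType.Exports.
Unset Printing Implicit Defensive.
Local Open Scope classical_set_scope.
Local Open Scope complex_scope.
Local Open Scope ring_scope.

(* With x = W(t) one has M(x) = t and cx + d = Delta / (a - ct), so D_x is d/dt
   along the curve. In the parameter t the powers of cx + d cancel, and the
   function under D_x^n is a constant multiple of f(t)^n w(t): both identities
   reduce to the Rodrigues formula of P_n at t. *)

(** * Differentiation of complex-valued functions of a real variable *)

Lemma derive1Zl (R : realType) (k : R) (g : R -> R) (t : R) :
  derive1 (fun s => k * g s) t = k * derive1 g t.
Proof.
have [->|k0] := eqVneq k 0.
  rewrite mul0r (_ : (fun _ => _) = cst 0) ?derive1_cst //.
  by apply/funext => s; rewrite mul0r.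
rewrite /derive1.
set G := fun h : R => h^-1 *: (g (h + t) - g t).
have -> : (fun h => h^-1 *: (k * g (h + t) - k * g t)) = k *: G :> (R -> R).
  by apply/funext => h; rewrite /G fctE -mulrBr /GRing.scale /= mulrCA.
have [cG|dG] := pselect (cvg (G @ 0^')); first by rewrite limZl_tmp.
(* A divergent limit is the junk value [point], which is 0 in R. *)
have dkG : ~ cvg (k *: G @ 0^') by rewrite is_cvgZlE.
by rewrite (dvgP dG) (dvgP dkG) mulr0.
Qed.

Lemma near_eq_derive1 (R : realType) (g h : R -> R) (t : R) :
  (\near t, g t = h t) -> derive1 g t = derive1 h t.
Proof. by move=> e; rewrite !derive1E; exact: near_eq_derive. Qed.

Lemma near_eq_derive1C (R : realType) (g h : R -> R[i]) (t : R) :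
  (\near t, g t = h t) -> derive1C g t = derive1C h t.
Proof.
move=> e; congr Complex; apply: near_eq_derive1;
  by apply: filterS e => s ->.
Qed.

(** The components of [k * g] are the real multiples [Re k * g] and [Im k * g]. The function under
    each iterate of [Dx] has this shape along the curve. *)
Lemma derive1C_real (R : realType) (k : R[i]) (g : R -> R) (t : R) :
  derive1C (fun s => k * (g s)%:C) t = k * (derive1 g t)%:C.
Proof.
rewrite /derive1C; case: k => k1 k2.
rewrite (_ : (fun s => complex.Re _) = fun s => k1 * g s); last first.
  by apply/funext => s /=; rewrite mulr0 subr0.
rewrite (_ : (fun s => complex.Im _) = fun s => k2 * g s); last first.
  by apply/funext => s /=; rewrite mulr0 add0r.
rewrite !derive1Zl; apply/eqP.
by rewrite eq_complex /= !mulr0 subr0 add0r !eqxx.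
Qed.

(** Existence is recorded together with the value, since the product and inverse rules require
    differentiable components. *)
Definition is_derive1C {R : realType} (t : R) (h : R -> R[i]) (v : R[i]) :=
  is_derive t (1 : R) (fun s => complex.Re (h s)) (complex.Re v) /\
  is_derive t (1 : R) (fun s => complex.Im (h s)) (complex.Im v).

Section is_derive1C.
Variables (R : realType) (t : R).
Implicit Types (h k : R -> R[i]) (u v p q : R[i]).

Lemma derive1C_val h v : is_derive1C t h v -> derive1C h t = v.
Proof.
case: v => v1 v2 [dre dim].
by rewrite /derive1C !derive1E (@derive_val _ _ _ _ _ _ _ dre)
  (@derive_val _ _ _ _ _ _ _ dim).
Qed.

Lemma is_derive1C_affine p q : is_derive1C t (fun s => p * s%:C + q) p.
Proof.
case: p q => [p1 p2] [q1 q2]; split.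
  rewrite (_ : (fun _ => _) = (p1 \*: id) + cst q1); last first.
    by apply/funext => s; rewrite /= mulr0 subr0.
  by apply: is_derive_eq; rewrite addr0 /GRing.scale /= mulr1.
rewrite (_ : (fun _ => _) = (p2 \*: id) + cst q2); last first.
  by apply/funext => s; rewrite /= mulr0 add0r.
by apply: is_derive_eq; rewrite addr0 /GRing.scale /= mulr1.
Qed.

Lemma is_derive1CM h k u v : is_derive1C t h u -> is_derive1C t k v ->
  is_derive1C t (fun s => h s * k s) (u * k t + h t * v).
Proof.
move=> [hr hi] [kr ki]; split.
  rewrite (_ : (fun _ => _) = (fun s => complex.Re (h s)) *
      (fun s => complex.Re (k s)) - (fun s => complex.Im (h s)) *
      (fun s => complex.Im (k s))); last first.
    by apply/funext => s; rewrite !fctE; case: (h s) (k s) => [? ?] [].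
  apply: is_derive_eq (is_deriveB (is_deriveM hr kr) (is_deriveM hi ki)) _.
  by case: u v (h t) (k t) {hr hi kr ki} => [? ?] [? ?] [? ?] [? ?] /=;
    rewrite /GRing.scale /=; ring.
rewrite (_ : (fun _ => _) = (fun s => complex.Re (h s)) *
    (fun s => complex.Im (k s)) + (fun s => complex.Im (h s)) *
    (fun s => complex.Re (k s))); last first.
  by apply/funext => s; rewrite !fctE; case: (h s) (k s) => [? ?] [].
apply: is_derive_eq (is_deriveD (is_deriveM hr ki) (is_deriveM hi kr)) _.
by case: u v (h t) (k t) {hr hi kr ki} => [? ?] [? ?] [? ?] [? ?] /=;
  rewrite /GRing.scale /=; ring.
Qed.

Lemma sqr_norm_neq0 (z : R[i]) : z != 0 ->
  complex.Re z ^+ 2 + complex.Im z ^+ 2 != 0.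
Proof.
case: z => x y; rewrite eq_complex /=.
by rewrite paddr_eq0 ?sqr_ge0 // !sqrf_eq0.
Qed.

Lemma invcE (z : R[i]) : let q := complex.Re z ^+ 2 + complex.Im z ^+ 2 in
  z^-1 = Complex (complex.Re z / q) (- (complex.Im z / q)).
Proof. by case: z. Qed.

Lemma is_derive1CV h v : h t != 0 -> is_derive1C t h v ->
  is_derive1C t (fun s => (h s)^-1) (- (v / h t ^+ 2)).
Proof.
move=> h0 [hr hi].
pose re s := complex.Re (h s); pose im s := complex.Im (h s).
(* The squared modulus of [h] is the common denominator of both components of [1 / h], so the real
   quotient calculus suffices. *)
pose q : R -> R := re ^+ 2 + im ^+ 2.
have q0 : q t != 0 by exact: sqr_norm_neq0.
have dq : is_derive t (1 : R) q
    (2 * (re t * complex.Re v + im t * complex.Im v)).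
  apply: is_derive_eq (is_deriveD (is_deriveX 2 hr) (is_deriveX 2 hi)) _.
  by rewrite /GRing.scale /= !expr1 /re /im; ring.
have qV := is_deriveV q0 dq.
rewrite -exprVn [(h t)^-1]invcE.
split.
  rewrite (_ : (fun _ => _) = re * (fun s => (q s)^-1)); last first.
    by apply/funext => s; rewrite invcE.
  apply: is_derive_eq (is_deriveM hr qV) _.
  move: q0; rewrite /q !fctE /re /im.
  case: v (h t) {hr hi qV dq h0} => [v1 v2] [x y] /= q0.
  rewrite /GRing.scale /=.
  by field.
rewrite (_ : (fun _ => _) = - (im * (fun s => (q s)^-1))); last first.
  by apply/funext => s; rewrite invcE.
apply: is_derive_eq (is_deriveN (is_deriveM hi qV)) _.
move: q0; rewrite /q !fctE /re /im.
case: v (h t) {hr hi qV dq h0} => [v1 v2] [x y] /= q0.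
rewrite /GRing.scale /=.
by field.
Qed.
End is_derive1C.

Lemma open_ointerval (R : realType) (l r : \bar R) : open (ointerval l r).
Proof. by apply: openI; [exact: open_ereal_gt|exact: open_ereal_lt]. Qed.

(** One component is nonzero at [t]; being differentiable it is continuous, hence nonzero nearby. *)
Lemma affine_near_neq0 (R : realType) (p q : R[i]) (t : R) :
  p * t%:C + q != 0 -> \near t, p * t%:C + q != 0.
Proof.
have [dr di] := is_derive1C_affine R t p q.
have cont (g : R -> R) (g' : R) : is_derive t (1 : R) g g' ->
    {for t, continuous g}.
  move=> dg; apply: differentiable_continuous.
  by apply/derivable1_diffP; exact: (@ex_derive _ _ _ _ _ _ _ dg).
rewrite eq_complex negb_and => /orP[n0|n0].
- apply: filterS (cvgr_neq0 _ (cont _ _ dr) n0) => s.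
  by apply: contraNneq => ->.
- apply: filterS (cvgr_neq0 _ (cont _ _ di) n0) => s.
  by apply: contraNneq => ->.
Qed.

(** * The parametrized curve and the operator [Dx] on it *)

Section moebius_curve.
Variables (R : realType) (a b c d : R[i]).
Hypothesis Delta0 : a * d - b * c != 0.
Let Delta := a * d - b * c.
Let W := @moebius_inv R a b c d.
Let M := @moebius R a b c d.

Lemma moebius_denomE (t : R) : c * t%:C != a ->
  c * W t + d = - (Delta / (c * t%:C - a)).
Proof.
by rewrite -subr_eq0 => ct; rewrite /W /moebius_inv /Delta; field.
Qed.

Lemma moebius_denom_neq0 (t : R) : c * t%:C != a -> c * W t + d != 0.
Proof.
move=> ct; rewrite moebius_denomE// oppr_eq0 mulf_neq0//.
by rewrite invr_eq0 subr_eq0.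
Qed.

Lemma moebius_invK (t : R) : c * t%:C != a -> M (W t) = t%:C.
Proof.
move=> ct; rewrite /M /moebius -/(W t) moebius_denomE //.
rewrite -subr_eq0 in ct; rewrite /W /moebius_inv /Delta.
by field; rewrite ct Delta0.
Qed.

Lemma near_moebius_regular (t : R) : c * t%:C != a -> \near t, c * t%:C != a.
Proof.
rewrite -subr_eq0 => /affine_near_neq0; apply: filterS => s.
by rewrite subr_eq0.
Qed.

(** The value is [1 / M'(x)] at [x = W t], computed directly from [W] as a quotient of affine
    maps. *)
Lemma derive_moebius_inv (t : R) : c * t%:C != a ->
  derive1C W t = (c * W t + d) ^+ 2 / Delta.
Proof.
move=> ct; have ct' := ct; rewrite -subr_eq0 in ct'.
rewrite moebius_denomE //.
have -> : W = fun s => (- d * s%:C + b) * (c * s%:C + - a)^-1.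
  by apply/funext => s; rewrite /W /moebius_inv -mulNr opprB addrC mulNr.
have := is_derive1CM _ _ _ _ _ _ (is_derive1C_affine R t (- d) b)
  (is_derive1CV _ _ _ _ ct' (is_derive1C_affine R t c (- a))).
move=> /derive1C_val ->.
move: Delta0; rewrite /Delta => D0.
by field; rewrite ct' D0.
Qed.

Lemma curve_derive_moebius (t : R) : c * t%:C != a ->
  curve_derive a b c d M (W t) = Delta / (c * W t + d) ^+ 2.
Proof.
move=> ct; rewrite /curve_derive -/M moebius_invK //=.
(* [M (W s) = s] holds only away from the pole of [W], hence an equality near [t]; the factor 1 fits
   [derive1C_real]. *)
rewrite (near_eq_derive1C _ _ (fun s => 1 * s%:C)); last first.
  apply: filterS (near_moebius_regular _ ct) => s cs.
  by rewrite mul1r -(moebius_invK _ cs).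
rewrite (derive1C_real _ 1 id) derive1_id mulr1.
by rewrite derive_moebius_inv // mul1r invf_div.
Qed.

(** Both curve derivatives in [Dx] carry the factor [1 / W'(t)], which cancels. *)
Lemma DxE (phi : R[i] -> R[i]) (t : R) : c * t%:C != a ->
  Dx a b c d phi (W t) = derive1C (phi \o W) t.
Proof.
move=> ct; have u0 := moebius_denom_neq0 _ ct.
rewrite /Dx curve_derive_moebius // /curve_derive -/M moebius_invK //=.
rewrite derive_moebius_inv //.
set v := derive1C (phi \o W) t; rewrite -/v.
by field; rewrite u0 Delta0.
Qed.

(** Induction on [n] through [DxE]: openness of [U] turns the induction hypothesis into an equality
    near [t], which may be differentiated. *)
Lemma iter_DxE (U : set R) (k : R[i]) (phi : R[i] -> R[i]) (g : R -> R) :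
  open U -> (forall t, U t -> c * t%:C != a) ->
  (forall t, U t -> phi (W t) = k * (g t)%:C) ->
  forall n t, U t -> iter n (Dx a b c d) phi (W t) = k * (derive1n n g t)%:C.
Proof.
move=> oU Ua phiE; elim=> [|n IHn] t Ut; first exact: phiE.
rewrite iterS DxE; last exact: Ua.
rewrite (near_eq_derive1C _ _ (fun s => k * (derive1n n g s)%:C)).
  by rewrite derive1C_real.
by apply: filterS (open_nbhs_nbhs (conj oU Ut)) => s /IHn.
Qed.
End moebius_curve.

Theorem theorem10 (R : realType) (l r : \bar R) (w : R -> R)
    (P : nat -> {poly R}) (eps : nat -> R) (f : {poly R}) (a b c d : R[i])
    (hlr : (l < r)%E)
    (hw0 : forall t : R, ointerval l r t -> w t != 0)
    (hw : smooth_on (ointerval l r) w)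
    (hP : orthogonal_polynomials l r w P)
    (hf : (size f <= 3)%N)
    (hrod : rodrigues l r w P eps f)
    (hDelta : a * d - b * c != 0) :
  let Delta : R[i] := a * d - b * c in
  let M : R[i] -> R[i] := moebius a b c d in
  let D : (R[i] -> R[i]) -> R[i] -> R[i] := Dx a b c d in
  let Rn : nat -> R[i] -> R[i] := fun n x => complex_eval (P n) (M x) in
  let Qn : nat -> R[i] -> R[i] :=
    fun n x => (c * x + d) ^+ n * complex_eval (P n) (M x) in
  let F : R[i] -> R[i] :=
    fun x => (c * x + d) ^+ 4 / Delta ^+ 2 * complex_eval f (M x) in
  let omega : R[i] -> R[i] :=
    fun x => Delta * (on_real w (M x) / (c * x + d) ^+ 2) in
  let omegann : nat -> R[i] -> R[i] :=
    fun n x => omega x / (c * x + d) ^+ (2 * n) in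
  (forall (phi : R[i] -> R[i]) (x : R[i]), Gamma l r a b c d x ->
     D phi x = (c * x + d) ^+ 2 / Delta * curve_derive a b c d phi x) /\
  (forall (n : nat) (x : R[i]), Gamma l r a b c d x ->
     Rn n x = Delta ^+ (2 * n) / (c * x + d) ^+ 2 * ((eps n)%:C / omega x)
              * iter n D (fun y : R[i] =>
                  F y ^+ n / (c * y + d) ^ (4 * n%:Z - 2) * omega y) x
     /\
     Qn n x = Delta ^+ (2 * n) / (c * x + d) ^+ (n + 2)
              * ((eps n)%:C / omegann n x)
              * iter n D (fun y : R[i] =>
                  F y ^+ n / (c * y + d) ^ (2 * n%:Z - 2) * omegann n y) x).
Proof.
move=> Delta M D Rn Qn F omega omegann.
(* The parameters of the finite points of the curve. *)
pose U := ointerval l r `&` [set t : R | c * t%:C != a].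
have oU : open U.
  apply: openI; first exact: open_ointerval.
  by rewrite openE => t /near_moebius_regular.
have Ua t : U t -> c * t%:C != a by case.
split=> [phi x [t [lrt ct ->]]|n x [t [lrt ct ->]]].
  by rewrite /D /Dx curve_derive_moebius// invf_div.
have evalE (p : {poly R}) s : U s ->
    complex_eval p (M (moebius_inv a b c d s)) = (p.[s])%:C.
  by move=> [_ cs]; rewrite /M moebius_invK// /complex_eval horner_map.
have omegaE s : U s -> omega (moebius_inv a b c d s) =
    Delta * ((w s)%:C / (c * moebius_inv a b c d s + d) ^+ 2).
  by move=> [_ cs]; rewrite /omega /on_real /M moebius_invK.
pose g s := f.[s] ^+ n * w s.
have PE := hrod n t lrt.
have w0 : (w t)%:C != 0 by rewrite fmorph_eq0 hw0.
have u0 s : U s -> c * moebius_inv a b c d s + d != 0.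
  by move=> [_]; exact: moebius_denom_neq0.
have D0 : Delta != 0 by [].
have Ut : U t by [].
(* The exponent is negative at [n = 0], so it is an integer power and the base must be nonzero. [m]
   is 4 for [Rn] and 2 for [Qn]. *)
have zexp (m : nat) (u : R[i]) : u != 0 ->
    u ^ (m%:Z * n%:Z - 2) = u ^+ (m * n) / u ^+ 2.
  by move=> un0; rewrite expfzDr.
have FE s : U s -> F (moebius_inv a b c d s) ^+ n =
    (c * moebius_inv a b c d s + d) ^+ (4 * n) / Delta ^+ (2 * n)
    * (f.[s] ^+ n)%:C.
  move=> Us; rewrite /F evalE// (exprMn _ (_ / _)) expr_div_n.
  by rewrite -!exprM rmorphXn.
split.
  (* The powers of [u = c x + d] cancel: [u ^ (4n)] from [F], [u ^ (2 - 4n)] and [u ^ (-2)] from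
     [omega]. [omega] leaves [Delta] and [F ^+ n] leaves [1 / Delta ^+ (2 * n)]. *)
  rewrite (iter_DxE _ _ _ _ _ hDelta U (Delta / Delta ^+ (2 * n)) _ g) //;
    last first.
    move=> s Us; rewrite zexp ?u0// FE// omegaE// /g rmorphM /=.
    have := u0 _ Us; set u := c * _ + d => un0.
    by field; rewrite !expf_neq0 ?un0 ?D0.
  (* The prefactor equals [Delta ^+ (2 * n) / Delta * eps n / w t]; it absorbs the constant above
     and leaves the Rodrigues formula. *)
  rewrite /Rn evalE// omegaE// PE !rmorphM fmorphV.
  have := u0 _ Ut; set u := c * _ + d => un0.
  by field; rewrite expf_neq0 ?un0 ?w0 ?D0.
rewrite {1}/D.
(* The constant is unchanged: the smaller divisor [u ^ (2n - 2)] is offset by the extra [u ^ (2n)]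
   in [omegann]. *)
rewrite (iter_DxE _ _ _ _ _ hDelta U (Delta / Delta ^+ (2 * n)) _ g) //;
  last first.
  move=> s Us; rewrite zexp ?u0// FE// /omegann omegaE// /g rmorphM /=.
  have := u0 _ Us; set u := c * _ + d => un0.
  (* Splitting [4n] as [2n + 2n] makes [u ^+ (2 * n)] a common atom for [field]. *)
  rewrite (mulnDl 2 2 n) exprD.
  by field; rewrite !expf_neq0 ?un0 ?D0.
rewrite /Qn evalE// /omegann omegaE// PE !rmorphM fmorphV.
have := u0 _ Ut; set u := c * _ + d => un0.
(* With everything written in [u ^+ n], the quotient of [u ^ (2n + 2)] by [u ^ (n + 2)] gives the
   factor [u ^+ n] of [Qn]. *)
rewrite !mul2n -!addnn !exprD.
by field; rewrite !expf_neq0 ?un0 ?w0 ?D0.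
Qed.
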